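(* Let $k$ be a field, let $n\ge 1$ be an integer, and let $Q$ be a quiver of type $\mathbb{A}_n$ (with arbitrary orientation of the edges). Then any representation of $Q$ over $k$ (not necessarily finite-dimensional) is a direct sum of thin representations.
   Context: A quiver of type $\mathbb{A}_n$ is a quiver with vertices $1,2,\dots,n$ whose underlying graph is the path $1 - 2 - \cdots - n$; that is, for each $1\le i<n$ there is exactly one arrow between $i$ and $i+1$, in either one of the two directions, and there are no other arrows. A representation $M$ of $Q$ over $k$ consists of a $k$-vector space $M_x$ (of arbitrary, possibly infinite, dimension) for each vertex $x$ and a $k$-linear map $M_\alpha: M_y\to M_z$ for each arrow $\alpha: y\to z$. Direct sums (possibly with infinitely many summands) are formed vertexwise and arrowwise. A representation $M$ is thin if all its Jordan–Hölder multiplicities are $0$ or $1$, i.e. $\dim_k M_x\le 1$ for every vertex $x$. *)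

(* Defs.v *)
(* MathComp; the classical layer of MathComp-Analysis is used only for
   finite_set and for the eqType/choiceType structures on direct sums. *)
From HB Require Import structures.
From mathcomp Require Import all_boot all_order all_algebra.
From mathcomp Require Import boolp classical_sets functions cardinality.

Set Implicit Arguments.
Unset Strict Implicit.
Unset Printing Implicit Defensive.

Import GRing.Theory.
Local Open Scope ring_scope.
Local Open Scope classical_set_scope.

Record quiver (V : Type) := Quiver {
  arrow : Type;
  source : arrow -> V;
  target : arrow -> V }.

Arguments source {V q} _.
Arguments target {V q} _.

Definition joins (V : Type) (Q : quiver V) (x y : V) (a : arrow Q) : Prop :=
  (source a = x /\ target a = y) \/ (source a = y /\ target a = x).

(* The vertices 1, ..., n are numbered 0, ..., n-1. *)
Definition quiver_type_A (n : nat) (Q : quiver 'I_n) : Prop :=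
  (forall x y : 'I_n, (y : nat) = x.+1 -> exists! a : arrow Q, joins x y a) /\
  (forall a : arrow Q, exists x y : 'I_n, (y : nat) = x.+1 /\ joins x y a).

Record representation (k : fieldType) (V : Type) (Q : quiver V) := Repr {
  rep_space :> V -> lmodType k;
  rep_map : forall a : arrow Q,
    {linear rep_space (source a) -> rep_space (target a)} }.

Definition rep_iso (k : fieldType) (V : Type) (Q : quiver V)
    (M N : representation k Q) : Prop :=
  exists f : forall x : V, {linear M x -> N x},
    (forall x : V, bijective (f x)) /\
    (forall (a : arrow Q) (v : M (source a)),
       f (target a) (rep_map M a v) = rep_map N a (f (source a) v)).

(* Vector.axiom d E is the type of linear isomorphisms from E to 'rV[k]_d. *)
Definition has_dim (k : fieldType) (E : lmodType k) (d : nat) : Prop :=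
  inhabited (Vector.axiom d E).

Definition thin (k : fieldType) (V : Type) (Q : quiver V)
    (M : representation k Q) : Prop :=
  forall x : V, exists2 d : nat, (d <= 1)%N & has_dim (M x) d.

(* External direct sum of an arbitrary family of vector spaces: the families of
   vectors with finite support, with pointwise operations. *)
Record dsum (k : fieldType) (I : Type) (E : I -> lmodType k) := Dsum {
  dsum_val :> forall i : I, E i;
  dsum_finite : finite_set [set i | dsum_val i <> 0] }.

Section DsumLmodule.
Variables (k : fieldType) (I : Type) (E : I -> lmodType k).
Implicit Types u v w : dsum E.

Lemma dsum_eq u v : (forall i, u i = v i) -> u = v.
Proof.
case: u v => [f hf] [g hg] /= fg.
have {}fg : f = g by apply: functional_extensionality_dep.
by case: g / fg hg => hg; congr Dsum; apply: Prop_irrelevance.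
Qed.

Lemma dsum_zero_finite : finite_set [set i : I | (0 : E i) <> 0].
Proof. by apply: (sub_finite_set _ (@finite_set0 I)) => i /=. Qed.

Lemma dsum_opp_finite u : finite_set [set i | - u i <> 0].
Proof.
apply: (sub_finite_set _ (dsum_finite u)) => i /= h ui.
by apply: h; rewrite ui oppr0.
Qed.

Lemma dsum_add_finite u v : finite_set [set i | u i + v i <> 0].
Proof.
have fin : finite_set ([set i | u i <> 0] `|` [set i | v i <> 0]).
  by rewrite finite_setU; split; apply: dsum_finite.
apply: (sub_finite_set _ fin) => i /= h.
have [ui|] := pselect (u i = 0); last by left.
by right => vi; apply: h; rewrite ui vi addr0.
Qed.

Lemma dsum_scale_finite (c : k) u : finite_set [set i | c *: u i <> 0].
Proof.
apply: (sub_finite_set _ (dsum_finite u)) => i /= h ui.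
by apply: h; rewrite ui scaler0.
Qed.

Definition dsum_zero : dsum E := Dsum dsum_zero_finite.
Definition dsum_opp u : dsum E := Dsum (dsum_opp_finite u).
Definition dsum_add u v : dsum E := Dsum (dsum_add_finite u v).
Definition dsum_scale (c : k) u : dsum E := Dsum (dsum_scale_finite c u).

HB.instance Definition _ := gen_eqMixin (dsum E).
HB.instance Definition _ := gen_choiceMixin (dsum E).

Lemma dsum_addA : associative dsum_add.
Proof. by move=> u v w; apply: dsum_eq => i /=; rewrite addrA. Qed.

Lemma dsum_addC : commutative dsum_add.
Proof. by move=> u v; apply: dsum_eq => i /=; rewrite addrC. Qed.

Lemma dsum_add0 : left_id dsum_zero dsum_add.
Proof. by move=> u; apply: dsum_eq => i /=; rewrite add0r. Qed.

Lemma dsum_addN : left_inverse dsum_zero dsum_opp dsum_add.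
Proof. by move=> u; apply: dsum_eq => i /=; rewrite addNr. Qed.

HB.instance Definition _ :=
  GRing.isZmodule.Build (dsum E) dsum_addA dsum_addC dsum_add0 dsum_addN.

Lemma dsum_scaleA (b c : k) u :
  dsum_scale b (dsum_scale c u) = dsum_scale (b * c) u.
Proof. by apply: dsum_eq => i /=; rewrite scalerA. Qed.

Lemma dsum_scale1 : left_id 1 dsum_scale.
Proof. by move=> u; apply: dsum_eq => i /=; rewrite scale1r. Qed.

Lemma dsum_scaleDr : right_distributive dsum_scale +%R.
Proof. by move=> c u v; apply: dsum_eq => i /=; rewrite scalerDr. Qed.

Lemma dsum_scaleDl u : {morph dsum_scale^~ u : b c / b + c}.
Proof. by move=> b c; apply: dsum_eq => i /=; rewrite scalerDl. Qed.

HB.instance Definition _ := GRing.Zmodule_isLmodule.Build k (dsum E)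
  dsum_scaleA dsum_scale1 dsum_scaleDr dsum_scaleDl.

End DsumLmodule.

Section DsumMap.
Variables (k : fieldType) (I : Type) (E F : I -> lmodType k).
Variable f : forall i : I, {linear E i -> F i}.

Lemma dsum_map_finite (u : dsum E) : finite_set [set i | f i (u i) <> 0].
Proof.
apply: (sub_finite_set _ (dsum_finite u)) => i /= h ui.
by apply: h; rewrite ui linear0.
Qed.

Definition dsum_map (u : dsum E) : dsum F := Dsum (dsum_map_finite u).

Lemma dsum_map_is_linear : linear dsum_map.
Proof. by move=> c u v; apply: dsum_eq => i /=; rewrite linearP. Qed.

HB.instance Definition _ :=
  GRing.isLinear.Build k (dsum E) (dsum F) *:%R dsum_map dsum_map_is_linear.

End DsumMap.

Definition rep_dsum (k : fieldType) (V : Type) (Q : quiver V) (I : Type)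
    (N : I -> representation k Q) : representation k Q :=
  @Repr k V Q (fun x : V => dsum (fun i : I => N i x))
    (fun a : arrow Q => dsum_map (fun i : I => rep_map (N i) a)).

(* Main.v *)
Require Import Defs.
From HB Require Import structures.
From mathcomp Require Import all_boot all_order all_algebra.
From mathcomp Require Import boolp classical_sets functions cardinality fsbigop.

(** Call bar a vector s z in each M z such that every arrow sends the vector at
    its source to the vector at its target, or to zero. The lines k (s z) of a
    bar form a thin representation, and M is the direct sum of these as soon as
    a family of bars provides, at each vertex, a basis of M z together with
    zero vectors ([bars_decomposition]).

    Such a family is built by sweeping the path from one end to the other
    ([bars_upto]). What has to be remembered about the part already swept is
    only a chain of subspaces of the space at the current vertex y: every basis
    of M y containing a basis of each member of the chain is the set of nonzero
    values at y of a family of bars on the swept part. Let x be the next vertex.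
    If the arrow is f : M y -> M x, the new chain consists of the images under f
    and the whole of M x ([transfer_along]); if it is g : M x -> M y, it
    consists of the preimages under g and the kernel of g
    ([transfer_against]). A basis of M x adapted to the new chain is matched
    with a basis of M y adapted to the old one: in the first case the basis
    vectors in the range of f are lifted along f, in the second those outside
    the kernel of g are pushed along g, and the resulting free set is completed.
    Matched vectors belong to the same bar, the others end or start one.

    In arbitrary dimension, the completion is an application of Zorn's lemma
    ([adapted_extension]), for which it is enough that the chains are
    well-ordered by inclusion; images and preimages of chains keep this
    property, so that no indexing of the chains is needed. *)

Set Implicit Arguments.
Unset Strict Implicit.
Unset Printing Implicit Defensive.

Import GRing.Theory.
Local Open Scope ring_scope.
Local Open Scope classical_set_scope.

(** * Spans and free sets in vector spaces of arbitrary dimension *)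

Section Span.
Variables (k : fieldType) (V : lmodType k).
Implicit Types (S T W : set V) (u v w : V).

Definition subspace W : Prop :=
  W 0 /\ forall (c : k) u v, W u -> W v -> W (c *: u + v).

Definition span S : set V := smallest subspace S.

(** Linear independence of [S] in the quotient by the span of [W], stated
    through spans alone: images, preimages and unions of chains then need no
    bookkeeping of coefficients. *)
Definition free_over W S : Prop :=
  forall v, S v -> ~ span (W `|` S `\ v) v.

Definition free S : Prop := free_over set0 S.

Lemma subspaceB W u v : subspace W -> W u -> W v -> W (u - v).
Proof. by move=> [_ WP] Wu Wv; rewrite addrC -scaleN1r; apply: WP. Qed.

Lemma subspaceD W u v : subspace W -> W u -> W v -> W (u + v).
Proof. by move=> [_ WP] Wu Wv; rewrite -[u]scale1r; apply: WP. Qed.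

Lemma subspaceZ W (c : k) u : subspace W -> W u -> W (c *: u).
Proof. by move=> [W0 WP] Wu; rewrite -[_ *: _]addr0; apply: WP. Qed.

Lemma subspaceZK W (c : k) u : subspace W -> c != 0 -> W (c *: u) -> W u.
Proof. by move=> Wsub cN0 /(subspaceZ c^-1 Wsub); rewrite scalerK. Qed.

Lemma subspaceT : subspace setT.
Proof. by []. Qed.

Lemma subspaceI W W' : subspace W -> subspace W' -> subspace (W `&` W').
Proof.
move=> [W0 WP] [W'0 W'P]; split=> // c u v [Wu W'u] [Wv W'v].
by split; [apply: WP | apply: W'P].
Qed.

Lemma subspace_span S : subspace (span S).
Proof.
split=> [W [[W0 _] _] // | c u v Su Sv W [Wsub SW]].
by apply: Wsub.2; [apply: Su | apply: Sv].
Qed.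

Lemma span0 S : span S 0.
Proof. exact: (subspace_span S).1. Qed.

Lemma sub_span S : S `<=` span S.
Proof. exact: sub_gen_smallest. Qed.

Lemma span_sub S W : subspace W -> S `<=` W -> span S `<=` W.
Proof. exact: smallest_sub. Qed.

Lemma span_mono S T : S `<=` T -> span S `<=` span T.
Proof.
move=> ST; apply: span_sub; first exact: subspace_span.
exact: subset_trans ST (@sub_span T).
Qed.

Lemma span_addP S v w :
  span (S `|` [set v]) w -> exists c, span S (w - c *: v).
Proof.
have [S0 SP] := subspace_span S.
pose W := [set w | exists c, span S (w - c *: v)].
apply: (@span_sub _ W) => [|u [Su|->]]; last 2 first; rewrite /W /=.
- by exists 0; rewrite scale0r subr0; apply: sub_span.
- by exists 1; rewrite scale1r subrr.
split=> [|c u u' [d ud] [d' ud']]; first by exists 0; rewrite scale0r subr0.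
exists (c * d + d').
by rewrite scalerDl -scalerA opprD addrACA -scalerBr; apply: SP.
Qed.

Lemma free_notin0 S : free S -> ~ S 0.
Proof. by move=> Sfree S0; apply: (Sfree _ S0); exact: span0. Qed.

Lemma free_over_sub W W' S S' :
  free_over W S -> W' `<=` span W -> S' `<=` S -> free_over W' S'.
Proof.
move=> Sfree WW SS v S'v vS; apply: (Sfree v (SS _ S'v)).
move: vS; apply: span_sub; first exact: subspace_span.
move=> u [/WW|[/SS Su uv]]; last by apply: sub_span; right.
by apply: span_mono => u' Wu'; left.
Qed.

Lemma free_add S v : free S -> ~ span S v -> free (S `|` [set v]).
Proof.
move=> Sfree vS b [Sb|->]; last first.
  apply: contra_not vS; apply: span_mono => u; rewrite set0U.
  by move=> [[//|->]] /(_ erefl).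
have -> : set0 `|` (S `|` [set v]) `\ b = S `\ b `|` [set v].
  rewrite set0U setDUl [X in _ `|` X = _]not_setD1 //= => bv.
  by apply: vS; rewrite -bv; apply: sub_span.
move=> /span_addP[c]; have [->|cN0] := eqVneq c 0.
  by rewrite scale0r subr0 => bS; apply: (Sfree b Sb); rewrite set0U.
move=> /(span_mono (@subDsetl _ _ _)) bv; apply: vS.
apply: (subspaceZK (subspace_span S) cN0).
have -> : c *: v = b - (b - c *: v) by rewrite opprB addrC subrK.
by apply: subspaceB (subspace_span S) _ bv; apply: sub_span.
Qed.

(** Only finitely many vectors of [S] are involved in a vector of its span. *)
Lemma span_finite S v : span S v ->
  exists2 r : seq V, uniq r /\ [set` r] `<=` S & span [set` r] v.
Proof.
pose W := [set v | exists2 r : seq V,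
  uniq r /\ [set` r] `<=` S & span [set` r] v].
apply: (@span_sub _ W) => [|u Su]; last first.
  exists [:: u]; last by apply: sub_span; rewrite /= inE.
  by split=> // w; rewrite /= inE => /eqP->.
split=> [|c u w [r [_ rS] ru] [t [_ tS] tw]].
  by exists [::]; [split | exact: span0].
exists (undup (r ++ t)).
  split=> [|x]; first exact: undup_uniq.
  by rewrite /= mem_undup mem_cat => /orP[/rS|/tS].
have [_] := subspace_span [set` undup (r ++ t)]; apply.
  by apply: span_mono ru => x /=; rewrite mem_undup mem_cat => ->.
by apply: span_mono tw => x /=; rewrite mem_undup mem_cat => ->; rewrite orbT.
Qed.

(** Peeling the vectors of a finite part of [S] off one by one: the first one
    with a nonzero coefficient would lie in the span of [W] and the others. *)
Lemma free_over_span0 W S u :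
  subspace W -> free_over W S -> span S u -> W u -> u = 0.
Proof.
move=> Wsub Sfree /span_finite[r [runiq rS] ru] Wu.
elim: r runiq rS u ru Wu => [|v r IHr] /= => [_ _ u|/andP[vr runiq] rS u].
  move=> u0 _; suff: [set 0] u by [].
  apply: span_sub u0 => //; split=> // c x y -> ->.
  by rewrite scaler0 addr0.
have rS' : [set` r] `<=` S by move=> x xr; apply: rS; rewrite /= inE xr orbT.
have -> : [set` v :: r] = [set` r] `|` [set v].
  apply/seteqP; split=> x /=; rewrite inE.
    by case/orP=> [/eqP|]; [right | left].
  by case=> [->|->]; rewrite ?orbT ?eqxx.
move=> /span_addP[c]; have [->|cN0] := eqVneq c 0.
  by rewrite scale0r subr0; apply: IHr.
move=> ru Wu; case: (Sfree v); first by apply: rS; rewrite /= inE eqxx.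
set X := W `|` _.
have Xsub := subspace_span X.
apply: (subspaceZK Xsub cN0); rewrite -[c *: v](subKr u).
apply: (subspaceB Xsub); first by apply: sub_span; left.
apply: span_mono ru => x /= xr; right; split; first exact: rS'.
by move=> xv; move: vr; rewrite -xv xr.
Qed.

End Span.

Section LinearImages.
Variables (k : fieldType) (U V : lmodType k) (f : {linear U -> V}).
Implicit Types (S : set U) (W : set V).

Definition kernel : set U := [set u | f u = 0].

Lemma subspace_image S : subspace S -> subspace (f @` S).
Proof.
move=> [S0 SP]; split=> [|c _ _ [u Su <-] [v Sv <-]].
  by exists 0; rewrite ?linear0.
by exists (c *: u + v); [apply: SP | rewrite linearP].
Qed.

Lemma subspace_preimage W : subspace W -> subspace (f @^-1` W).
Proof.
move=> [W0 WP]; split=> [|c u v /= Wu Wv]; first by rewrite /= linear0.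
by rewrite /= linearP; apply: WP.
Qed.

Lemma subspace_kernel : subspace kernel.
Proof.
split=> [|c u v /= fu fv]; first exact: linear0.
by rewrite /kernel /= linearP fu fv scaler0 addr0.
Qed.

Lemma span_image S : f @` span S = span (f @` S).
Proof.
apply/seteqP; split=> [_ [u Su <-]|]; last first.
  apply: span_sub => [|_ [u Su <-]].
    exact: subspace_image (subspace_span S).
  by exists u => //; apply: sub_span.
suff: span S `<=` f @^-1` span (f @` S) by apply.
apply: span_sub => [|v Sv]; first exact: subspace_preimage (subspace_span _).
by apply: sub_span; exists v.
Qed.

(** A linear map carries a relation modulo its kernel to a relation in the
    image, and conversely every relation in the image lifts. *)
Lemma free_over_kernelP S :
  (free_over kernel S) <-> (set_inj S f /\ free (f @` S)).
Proof.
split=> [Sfree|[finj fSfree] v Sv vS].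
  have lift v T : span (f @` T) (f v) -> span (kernel `|` T) v.
    rewrite -span_image => -[w Tw fwv].
    rewrite -[v](subrK w); apply: (subspaceD (subspace_span _)).
      by apply: sub_span; left; rewrite /kernel /= linearB fwv subrr.
    by apply: span_mono Tw => u Tu; right.
  split=> [u v /set_mem Su /set_mem Sv fuv|_ [v Sv <-]].
    have [//|/eqP uv] := eqVneq u v; case: (Sfree u Su); apply: lift.
    by rewrite fuv; apply: sub_span; exists v => //; split=> // /esym.
  rewrite set0U => vS; apply: (Sfree v Sv); apply: lift; move: vS.
  apply: span_mono => _ [[u Su <-] /= fuv]; exists u => //; split=> // uv.
  by apply: fuv; rewrite uv.
have fv : span (f @` (kernel `|` S `\ v)) (f v).
  by rewrite -span_image; exists v.
apply: (fSfree (f v)); first by exists v.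
move: fv; rewrite set0U; apply: span_sub; first exact: subspace_span.
move=> _ [u [fu|[Su uv]] <-]; first by rewrite fu; exact: span0.
apply: sub_span; split; first by exists u.
by move=> /= fuv; apply: uv; apply: finj; rewrite ?inE.
Qed.

End LinearImages.

(** * Bases adapted to a well-ordered family of subspaces *)

Section Flags.
Variables (k : fieldType) (V : lmodType k).
Implicit Types (F W S T : set V) (FF GG : set (set V)).

Definition well_ordered_by_inclusion FF : Prop :=
  forall GG, GG `<=` FF -> GG !=set0 ->
    exists2 F, GG F & forall G, GG G -> F `<=` G.

Definition flag FF : Prop :=
  FF `<=` subspace (V := V) /\ well_ordered_by_inclusion FF.

(** For free [T]: the trace of each member of the flag on the span of [T] is
    spanned by the elements of [T] that it contains. *)
Definition saturated FF T : Prop :=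
  forall F, FF F -> span T `&` F `<=` span (T `&` F).

(** If the flag contains the whole space, this says that [T] is a basis and
    contains a basis of each member of the flag. *)
Definition adapted FF T : Prop :=
  free T /\ forall F, FF F -> F `<=` span (T `&` F).

Lemma well_ordered_min FF (P : set (set V)) F0 :
  well_ordered_by_inclusion FF -> FF F0 -> P F0 ->
  exists F, [/\ FF F, P F & forall G, FF G -> P G -> F `<=` G].
Proof.
move=> FFwo F0F PF0; have [||F [FF_F PF] Fmin] := FFwo (FF `&` P).
- by move=> F [].
- by exists F0.
by exists F; split=> // G FG PG; apply: Fmin.
Qed.

Lemma flag_setT : flag [set setT].
Proof.
split=> [_ ->|GG GGT [F GF]]; first exact: subspaceT.
by exists F => // G /GGT->.
Qed.

Lemma flag_add_top FF : flag FF -> flag (FF `|` [set setT]).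
Proof.
move=> [FFsub FFwo]; split=> [F [/FFsub //|->]|GG GGF [F GF]].
  exact: subspaceT.
have [[G [GG_G FF_G]]|none] := pselect (exists G, GG G /\ FF G).
  have [||H [_ GG_H] Hmin] := FFwo (FF `&` GG); first by move=> ? [].
    by exists G.
  by exists H => // K GG_K; case: (GGF K GG_K) => [FF_K|->] //; apply: Hmin.
exists F => // G GG_G; case: (GGF G GG_G) => [FF_G|->] //.
by case: none; exists G.
Qed.

Lemma flag_add_bottom FF W :
  subspace W -> (forall F, FF F -> W `<=` F) -> flag FF ->
  flag (FF `|` [set W]).
Proof.
move=> Wsub Wmin [FFsub FFwo]; split=> [F [/FFsub|->]|GG GGF [F GF]] //.
have [GW|GW] := pselect (GG W).
  by exists W => // G /GGF[/Wmin|->].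
apply: FFwo; last by exists F.
by move=> G GG_G; case: (GGF G GG_G) => // GeqW; case: GW; rewrite -GeqW.
Qed.

(** If [F] is the least member of the flag not in the span of [T], then a member
    [G] is either in that span, where [v] brings nothing new, or contains [v],
    which can then be subtracted inside [G]. *)
Lemma saturated_add FF T F v : flag FF -> saturated FF T -> FF F -> F v ->
  (forall G, FF G -> ~ G `<=` span T -> F `<=` G) ->
  saturated FF (T `|` [set v]).
Proof.
move=> FFflag Tsat FF_F Fv Fmin G FF_G w [wTv Gw].
have Gsub := FFflag.1 G FF_G.
have mono := @span_mono _ _ (T `&` G) ((T `|` [set v]) `&` G).
have TG : T `&` G `<=` (T `|` [set v]) `&` G by move=> u [Tu Gu]; split; [left|].
have [GT|/(Fmin G FF_G) FG] := pselect (G `<=` span T).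
  by apply: (mono TG); apply: Tsat => //; split=> //; apply: GT.
have [c wT] := span_addP wTv.
rewrite -[w](subrK (c *: v)); apply: (subspaceD (subspace_span _)).
  apply: (mono TG); apply: Tsat => //; split=> //.
  exact: (subspaceB Gsub Gw (subspaceZ c Gsub (FG v Fv))).
apply: (subspaceZ _ (subspace_span _)); apply: sub_span; split; first by right.
exact: FG.
Qed.

(** Zorn's lemma gives a maximal free saturated set. If it missed a member of
    the flag, take the least such [F] and a vector [v] of [F] out of reach:
    adding [v] changes nothing in the members below [F], which are already
    spanned, and keeps saturation in those above [F], which contain [v]. So the
    larger set would again be free and saturated. *)
Lemma adapted_extension FF T : flag FF -> free T -> saturated FF T ->
  exists T', [/\ T `<=` T',
    T' `<=` T `|` \bigcup_(F in FF) F & adapted FF T'].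
Proof.
move=> FFflag Tfree Tsat.
pose P X := [/\ X `<=` \bigcup_(F in FF) F, free (T `|` X)
  & saturated FF (T `|` X)].
have P0 : P set0 by split; rewrite ?setU0.
have chainP CC : CC `<=` P -> total_on CC subset -> P (\bigcup_(X in CC) X).
  move=> CCP CCtot.
  (* A finite subset of the union lies in one member of the chain, or in [T]
     alone when the chain is empty. *)
  have fin (r : seq V) : [set` r] `<=` T `|` \bigcup_(X in CC) X ->
      exists2 X, P X /\ X `<=` \bigcup_(X in CC) X & [set` r] `<=` T `|` X.
    move=> rTX; suff [X XC rX] : exists2 X, X = set0 \/ CC X
      & [set` r] `<=` T `|` X.
      exists X => //; case: XC => [->|XC]; first by split.
      by split; [apply: CCP | move=> v Xv; exists X].
    elim: r rTX => [|v r IHr] rTX; first by exists set0; [left|].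
    have [|X XC rX] := IHr.
      by move=> u ur; apply: rTX; move: ur; rewrite /= inE orbC => ->.
    have [Tv|[Y YC Yv]] : (T `|` \bigcup_(X in CC) X) v.
      by apply: rTX; rewrite /= inE eqxx.
      by exists X => // u; rewrite /= inE => /orP[/eqP->|/rX]; [left|].
    have [Z ZC [XZ YZ]] : exists2 Z, CC Z & X `<=` Z /\ Y `<=` Z.
      case: XC => [->|XC]; first by exists Y => //; split=> // u.
      by case: (CCtot X Y XC YC) => ?; [exists Y | exists X] => //; split=> // u.
    exists Z; first by right.
    move=> u; rewrite /= inE => /orP[/eqP->|/rX[|/XZ]]; [|by left|by right].
    by right; apply: YZ.
  split=> [v [X /CCP[X_FF _ _] /X_FF] //|v Tv|F FF_F v [Tv Fv]].
    move=> /span_finite[r [_ rT] rv].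
    have [|X [[_ Xfree _] XC] rX] := fin (v :: r).
      move=> u; rewrite /= inE => /orP[/eqP->|/rT] //.
      by rewrite set0U => -[].
    apply: (Xfree v); first by apply: rX; rewrite /= inE eqxx.
    apply: span_mono rv => u ur; rewrite set0U; split.
      by apply: rX; move: ur; rewrite /= inE orbC => ->.
    by move/rT: ur; rewrite set0U => -[].
  have [r [_ rT] rv] := span_finite Tv.
  have [X [[_ _ Xsat] XC] rX] := fin r rT.
  have : span ((T `|` X) `&` F) v.
    by apply: Xsat => //; split=> //; apply: span_mono rv.
  by apply: span_mono => u [[Tu|/XC Xu] Fu]; split=> //; [left | right].
have [X [[XF Xfree Xsat] Xmax]] := Zorn_bigcup chainP.
exists (T `|` X); split; [exact: subsetUl|exact: setUS|split=> //].
suff FX F : FF F -> F `<=` span (T `|` X).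
  by move=> F FF_F v Fv; apply: Xsat => //; split=> //; apply: (FX F).
move=> FF_F; apply: contrapT => nFX.
have [{nFX FF_F}F [FF_F nFX Fmin]] := well_ordered_min
  (P := [set F | ~ F `<=` span (T `|` X)]) FFflag.2 FF_F nFX.
have /existsNP[v /not_implyP[Fv vX]] := nFX.
apply: (Xmax (X `|` [set v])).
  split=> [|/(_ v)]; first exact: subsetUl.
  by move=> Xv; apply: vX; apply: sub_span; right; apply: Xv; right.
split; rewrite ?setUA.
- by move=> u [/XF //|->]; exists F.
- exact: free_add.
- exact: saturated_add Fmin.
Qed.

End Flags.

Lemma well_ordered_image (k : fieldType) (U V : lmodType k)
    (h : set U -> set V) (FF : set (set U)) :
  {homo h : F G / F `<=` G} ->
  well_ordered_by_inclusion FF -> well_ordered_by_inclusion (h @` FF).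
Proof.
move=> hmono FFwo GG GGh [G0 GG_G0]; have [F0 FF_F0 hF0] := GGh G0 GG_G0.
have [|F [FF_F GG_F Fmin]] :=
  well_ordered_min (P := [set F | GG (h F)]) FFwo FF_F0.
  by rewrite /= hF0.
exists (h F) => // G GG_G; have [F' FF_F' hF'] := GGh G GG_G.
by rewrite -hF'; apply: hmono; apply: Fmin => //=; rewrite hF'.
Qed.

(** * Carrying adapted bases across an arrow *)

(** A partial bijection [s] between the sets [B] and [T]: an element of [B1] is
    [R]-related to its image, and the elements left over are [R]-related to
    zero. *)
Definition matching (k : fieldType) (U V : lmodType k) (R : U -> V -> Prop)
    (T : set U) (B : set V) : Prop :=
  exists (B1 : set V) (s : V -> U),
    [/\ B1 `<=` B, set_inj B1 s, s @` B1 `<=` T &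
      [/\ forall b, B1 b -> R (s b) b,
          forall t, (T `\` s @` B1) t -> R t 0 &
          forall b, (B `\` B1) b -> R 0 b]].

Section Transfer.
Variables (k : fieldType) (U V : lmodType k).
Variables (FF : set (set U)).
Hypotheses (FFflag : flag FF) (FFT : FF setT).

(** The flag consists of the images of the given one and the whole space. Each
    basis vector in the range is lifted to a preimage as deep in the flag as
    possible. The lifts span a complement of the kernel, hence form a saturated
    set for the traces of the flag on the kernel, and are completed by kernel
    vectors. *)
Lemma transfer_along (f : {linear U -> V}) :
  exists2 GG : set (set V), flag GG /\ GG setT &
    forall B, adapted GG B -> exists2 T, adapted FF T &
      matching (fun u v => f u = v \/ f u = 0) T B.
Proof.
have imflag : flag ([set f @` F | F in FF] `|` [set setT]).
  apply: flag_add_top; split=> [_ [F FF_F <-]|].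
    exact: subspace_image (FFflag.1 F FF_F).
  by apply: well_ordered_image FFflag.2; apply: image_subset.
exists ([set f @` F | F in FF] `|` [set setT]).
  by split=> //; right.
move=> B [Bfree Bgen].
have lift b : exists u, range f b ->
    f u = b /\ forall F, FF F -> (f @` F) b -> F u.
  have [fb|nfb] := pselect (range f b); last by exists 0.
  have [F [FF_F [u Fu <-] Fmin]] :=
    well_ordered_min (P := [set F | (f @` F) b]) FFflag.2 FFT fb.
  by exists u => _; split=> // G FF_G fGb; apply: (Fmin G FF_G fGb).
have [s sP] := choice lift.
pose B1 := B `&` range f; pose S := s @` B1.
have fs b : B1 b -> f (s b) = b by move=> [_ /sP[]].
have fS : f @` S = B1.
  apply/seteqP; split=> [_ [_ [b B1b <-] <-]|b B1b]; first by rewrite fs.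
  by exists (s b); [exists b | apply: fs].
have Sfree : free_over (kernel f) S.
  apply/free_over_kernelP; rewrite fS; split; last first.
    by apply: (free_over_sub Bfree) => [//|b []].
  move=> _ _ /set_mem[b B1b <-] /set_mem[b' B1b' <-].
  by rewrite !fs // => ->.
pose KK := [set F `&` kernel f | F in FF].
have KKflag : flag KK.
  split=> [_ [F FF_F <-]|].
    exact: subspaceI (FFflag.1 F FF_F) (subspace_kernel f).
  by apply: well_ordered_image FFflag.2 => F G FG; apply: setSI.
have Ssat : saturated KK S.
  move=> _ [F _ <-] u [Su [_ fu]].
  by rewrite (free_over_span0 (subspace_kernel f) Sfree Su fu); apply: span0.
have S_free : free S by apply: (free_over_sub Sfree).
have [T [ST TS [Tfree Tgen]]] := adapted_extension KKflag S_free Ssat.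
exists T; [split=> // F FF_F u Fu | exists B1, s; split=> //].
- (* Subtracting from [u] a combination [w] of lifts with the same image leaves
     a vector of the kernel. *)
  have : span (f @` (T `&` F)) (f u).
    have : (span (B `&` f @` F)) (f u).
      by apply: Bgen; [left; exists F | exists u].
    apply: span_mono => b [Bb fFb].
    have B1b : B1 b by split=> //; case: fFb => w _ <-; exists w.
    exists (s b); last exact: fs.
    split; first by apply: ST; exists b.
    by have [] := sP b B1b.2; move=> _; apply.
  rewrite -span_image => -[w Tw fw].
  have Fw : F w by move: Tw; exact: (span_sub (FFflag.1 F FF_F) (@subIsetr _ T F)).
  rewrite -[u](subrK w); apply: (subspaceD (subspace_span _)) => //.
  have : span (T `&` (F `&` kernel f)) (u - w).
    apply: Tgen; first by exists F.
    split; first exact: (subspaceB (FFflag.1 F FF_F)).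
    by rewrite /kernel /= linearB fw subrr.
  by apply: span_mono => x [Tx [Fx _]].
- by move=> b [].
- by move=> b b' /set_mem B1b /set_mem B1b' sb; rewrite -(fs b) // sb fs.
split=> [b B1b|t [Tt St]|b _]; [left; exact: fs | right | by right; apply: linear0].
by case: (TS t Tt) => // -[_ [F _ <-] []].
Qed.

(** The flag consists of the preimages of the given one and the kernel. The
    basis vectors outside the kernel are a basis of a complement of the kernel,
    so that their images are free; these images are completed to an adapted
    basis. *)
Lemma transfer_against (g : {linear V -> U}) :
  exists2 GG : set (set V), flag GG /\ GG setT &
    forall B, adapted GG B -> exists2 T, adapted FF T &
      matching (fun u v => g v = u \/ g v = 0) T B.
Proof.
have preflag : flag ([set g @^-1` F | F in FF] `|` [set kernel g]).
  apply: flag_add_bottom; first exact: subspace_kernel.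
    by move=> _ [F FF_F <-] v gv; rewrite /preimage /= gv; case: (FFflag.1 F FF_F).
  split=> [_ [F FF_F <-]|].
    exact: subspace_preimage (FFflag.1 F FF_F).
  by apply: well_ordered_image FFflag.2 => F G FG; apply: preimage_subset.
exists ([set g @^-1` F | F in FF] `|` [set kernel g]).
  by split=> //; left; exists setT; rewrite ?preimage_setT.
move=> B [Bfree Bgen].
pose B1 := B `\` kernel g.
have B1free : free_over (kernel g) B1.
  move=> b [Bb kb] bB1; apply: (Bfree b Bb); rewrite set0U.
  move: bB1; apply: span_sub; first exact: subspace_span.
  move=> v [kv|[[Bv _] vb]]; last by apply: sub_span.
  have : span (B `&` kernel g) v by apply: Bgen => //; right.
  by apply: span_mono => w [Bw kw]; split=> // wb; apply: kb; rewrite -wb.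
have [ginj gB1free] := (free_over_kernelP g B1).1 B1free.
have gB1sat : saturated FF (g @` B1).
  move=> F FF_F u []; rewrite -span_image => -[v B1v gv] Fu.
  have : span (B `&` g @^-1` F) v.
    by apply: Bgen; [left; exists F | rewrite /preimage /= gv].
  have -> : span (g @` B1 `&` F) u = (g @^-1` span (g @` B1 `&` F)) v.
    by rewrite /preimage /= gv.
  apply: span_sub; first exact: subspace_preimage (subspace_span _).
  move=> b [Bb Fb]; rewrite /preimage /=.
  have [->|/eqP gb] := eqVneq (g b) 0; first exact: span0.
  by apply: sub_span; split=> //; exists b.
have [T [B1T _ Tadapt]] := adapted_extension FFflag gB1free gB1sat.
exists T => //; exists B1, g; split=> //; first by move=> b [].
split=> [b _|t _|b [Bb nB1b]]; [by left | by right; apply: linear0 | right].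
by apply: contrapT => gb; apply: nB1b.
Qed.

End Transfer.

(** * Extending a family of bars by one vertex *)

Section Families.
Variables (k : fieldType).

(** Zero values are allowed and may be repeated: a bar is zero at the vertices
    that it does not reach. *)
Definition enumerates (E : lmodType k) (I : Type) (e : I -> E) (B : set E) :=
  [/\ forall i, e i != 0 -> B (e i),
      forall i j, e i != 0 -> e i = e j -> i = j
    & B `<=` range e].

Definition family_basis (E : lmodType k) (I : Type) (e : I -> E) : Prop :=
  exists B, [/\ free B, span B = setT & enumerates e B].

Definition restrict (E : lmodType k) (B : set E) (v : E) : E :=
  if `[< B v >] then v else 0.

Lemma restrict_neq0 (E : lmodType k) (B : set E) v :
  restrict B v != 0 -> B v /\ restrict B v = v.
Proof. by rewrite /restrict; case: asboolP => // _; rewrite eqxx. Qed.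

Lemma restrict_id (E : lmodType k) (B : set E) v : B v -> restrict B v = v.
Proof. by move=> Bv; rewrite /restrict asboolT. Qed.

(** Two members of the family are glued by following the matching, and each
    unmatched element of [B] starts a new member. *)
Lemma extend_family (V : eqType) (E : V -> lmodType k) (x y : V)
    (I : choiceType) (e : I -> forall z, E z) (R : E y -> E x -> Prop)
    (T : set (E y)) (B : set (E x)) :
  R 0 0 -> y != x -> free T -> enumerates (e^~ y) T -> matching R T B ->
  exists (J : choiceType) (e' : J -> forall z, E z),
    [/\ enumerates (e'^~ x) B,
        forall j, R (e' j y) (e' j x),
        forall z, z != x -> family_basis (e^~ z) -> family_basis (e'^~ z) &
        forall j, (exists i, forall z, z != x -> e' j z = e i z) \/
                  (forall z, z != x -> e' j z = 0)].
Proof.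
move=> R00 yx Tfree [eT einj eonto] [B1 [s [B1B sinj sT [RB1 RT RB]]]].
(* The value at [x] of the member [i]: the partner of its value at [y]. *)
have partner i : exists v, (B1 v /\ s v = e i y) \/
    ((forall b, B1 b -> s b <> e i y) /\ v = 0).
  have [[b [B1b sb]]|none] := pselect (exists b, B1 b /\ s b = e i y).
    by exists b; left.
  by exists 0; right; split=> // b B1b sb; apply: none; exists b.
have [c cP] := choice partner.
have TN0 t : T t -> t != 0.
  by move=> Tt; apply/eqP => t0; apply: (free_notin0 Tfree); rewrite -t0.
pose e' (j : I + E x) : forall z, E z :=
  match j with
  | inl i => @dfwith V E (e i) x (c i)
  | inr b => @dfwith V E (fun=> 0) x (restrict (B `\` B1) b)
  end.
have e'x j : e' j x = match j with
    | inl i => c i | inr b => restrict (B `\` B1) b end.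
  by case: j => [i|b]; rewrite /e' dfwith_in.
have e'l i z : z != x -> e' (inl i) z = e i z.
  by move=> zx; rewrite /e' dfwith_out // eq_sym.
have e'r b z : z != x -> e' (inr b) z = 0.
  by move=> zx; rewrite /e' dfwith_out // eq_sym.
exists (I + E x)%type, e'; split.
- split=> [[i|b]|[i|b] [j|b']|b Bb]; rewrite ?e'x.
  + case: (cP i) => [[/B1B //]|[_ ->]]; by rewrite eqxx.
  + by move/restrict_neq0 => [[Bb _] ->].
  + case: (cP i) => [[B1i si]|[_ ->]]; last by rewrite eqxx.
    move=> ciN0 cij; case: (cP j) => [[_ sj]|[_ cj]].
      congr inl; apply: einj; last by rewrite -si -sj cij.
      by apply: TN0; rewrite -si; apply: sT; exists (c i).
    by move: ciN0; rewrite cij cj eqxx.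
  + move=> ciN0 cib; move: (ciN0); rewrite cib => /restrict_neq0[[_ nB1] b'E].
    case: (cP i) => [[B1i _]|[_ ci0]]; last by rewrite ci0 eqxx in ciN0.
    by case: nB1; rewrite -b'E -cib.
  + move=> /[dup] bN0 /restrict_neq0[[_ nB1] bE] bcj.
    case: (cP j) => [[B1j _]|[_ cj0]]; last by rewrite bcj cj0 eqxx in bN0.
    by case: nB1; rewrite -bE bcj.
  + move=> /[dup] bN0 /restrict_neq0[_ bE] bb'.
    by move: bN0; rewrite bb' => /restrict_neq0[_ b'E]; rewrite -bE bb' b'E.
  + have [B1b|nB1b] := pselect (B1 b); last first.
      by exists (inr b) => //; rewrite e'x restrict_id.
    have [i _ ei] : range (e^~ y) (s b) by apply/eonto/sT; exists b.
    exists (inl i) => //; rewrite e'x.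
    case: (cP i) => [[B1i si]|[/(_ b B1b)]]; last by rewrite -ei.
    by apply: sinj; rewrite ?inE // si -ei.
- move=> [i|b]; rewrite e'x ?e'l ?e'r //.
    case: (cP i) => [[B1i <-]|[none ->]]; first exact: RB1.
    have [->|eN0] := eqVneq (e i y) 0; last first.
      apply: RT; split; first exact: eT.
      by move=> [b B1b] /(none b B1b).
    exact: R00.
  rewrite /restrict; case: asboolP => [/RB //|_]; exact: R00.
- move=> z zx [C [Cfree Cgen [eC eCinj eConto]]].
  exists C; split=> //; split=> [[i|b]|[i|b] [j|b']|v /eConto[i _ eiv]].
  + by rewrite e'l //; apply: eC.
  + by rewrite e'r // eqxx.
  + by rewrite !e'l // => eN0 /(eCinj _ _ eN0) ->.
  + by rewrite e'l // e'r // => /eqP.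
  + by rewrite e'r // eqxx.
  + by rewrite e'r // eqxx.
  + by exists (inl i) => //; rewrite e'l.
- by move=> [i|b]; [left; exists i => z; apply: e'l | right=> z; apply: e'r].
Qed.

End Families.

(** * Sweeping the path *)

Section Follows.
Variables (k : fieldType) (V : Type) (Q : quiver V) (M : representation k Q).

Definition follows (a : arrow Q) (s : forall z, M z) : Prop :=
  rep_map M a (s (source a)) = s (target a) \/ rep_map M a (s (source a)) = 0.

Lemma transfer_arrow (x y : V) (a : arrow Q) (FF : set (set (M y))) :
  joins y x a -> flag FF -> FF setT ->
  exists R : M y -> M x -> Prop,
    [/\ R 0 0, forall s, R (s y) (s x) -> follows a s &
      exists2 GG : set (set (M x)), flag GG /\ GG setT &
        forall B, adapted GG B -> exists2 T, adapted FF T & matching R T B].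
Proof.
move=> [[sy tx]|[sx ty]]; [subst y x | subst x y]; move=> FFflag FFT.
- exists (fun u v => rep_map M a u = v \/ rep_map M a u = 0); split=> //.
    by right; apply: linear0.
  exact: transfer_along.
- exists (fun u v => rep_map M a v = u \/ rep_map M a v = 0); split=> //.
    by right; apply: linear0.
  exact: transfer_against.
Qed.

End Follows.

Section Bars.
Variables (k : fieldType) (n : nat) (Q : quiver 'I_n) (M : representation k Q).
Hypothesis hQ : quiver_type_A Q.

(** Adding [x] to the vertices up to [y] adds only the arrow [a]. *)
Lemma type_A_last_arrow (x y : 'I_n) (a b : arrow Q) :
  x = y.+1 :> nat -> joins y x a ->
  (source b <= x)%N -> (target b <= x)%N ->
  b = a \/ (source b <= y /\ target b <= y)%N.
Proof.
move=> xy yxa sb tb; have [u [v [vu uvb]]] := hQ.2 b.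
have [vx|vx] := eqVneq v x.
  left; have [c [_ cuniq]] := hQ.1 y x xy.
  have uy : u = y by apply/val_inj/succn_inj; rewrite -vu vx xy.
  by rewrite -(cuniq a yxa); apply/esym/cuniq; rewrite -uy -vx.
right; have vy : (v <= y)%N.
  rewrite -ltnS -xy ltn_neqAle vx /=.
  by case: uvb sb tb => -[-> ->].
have uy : (u <= y)%N by apply: leq_trans vy; rewrite vu.
by case: uvb => -[-> ->].
Qed.

(** A flag at the current vertex is all that has to be remembered of the part
    already swept. The bars are carried by the whole quiver, but constrained
    only up to [x], so that they can be prolonged by changing their values at
    the next vertex. *)
Lemma bars_upto (x : 'I_n) : exists2 FF : set (set (M x)), flag FF /\ FF setT &
  forall B, adapted FF B -> exists (I : choiceType) (e : I -> forall z, M z),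
    [/\ enumerates (e^~ x) B,
        forall z : 'I_n, (z <= x)%N -> family_basis (e^~ z) &
        forall a : arrow Q, (source a <= x)%N -> (target a <= x)%N ->
          forall i, follows a (e i)].
Proof.
move: {2}(nat_of_ord x) (erefl (nat_of_ord x)) => t xt.
elim: t x xt => [|t IHt] x xt.
  (* At the first vertex every basis is allowed and gives bars supported there. *)
  exists [set setT]; first by split=> //; apply: flag_setT.
  move=> B [Bfree Bgen].
  have zx (z : 'I_n) : (z <= x)%N -> z = x.
    by rewrite xt leqn0 => /eqP z0; apply: val_inj; rewrite /= z0 xt.
  pose e (v : M x) := @dfwith 'I_n (rep_space M) (fun=> 0) x (restrict B v).
  have ex v : e v x = restrict B v by rewrite /e dfwith_in.
  have enum_x : enumerates (e^~ x) B.
    split=> [v|v w|v Bv]; rewrite ?ex.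
    - by move/restrict_neq0 => [Bv ->].
    - move=> /[dup] vN0 /restrict_neq0[_ vE] vw.
      by move: vN0; rewrite vw => /restrict_neq0[_ wE]; rewrite -vE vw wE.
    - by exists v => //; rewrite ex restrict_id.
  exists (M x : choiceType), e; split=> // [z /zx ->|a sa ta].
    exists B; split=> //; apply/seteqP; split=> // v _.
    by apply: span_mono (Bgen setT erefl v Logic.I) => w [].
  have [u [v [vu uva]]] := hQ.2 a.
  have : u = v by case: uva sa ta => -[-> ->] => [/zx-> /zx->|/zx-> /zx->].
  by move=> uv; move: vu; rewrite uv => /n_Sn.
have tn : (t < n)%N by apply: ltn_trans (ltn_ord x); rewrite xt.
pose y : 'I_n := Ordinal tn.
have xy : x = y.+1 :> nat by rewrite xt.
have yx : y != x by rewrite -val_eqE /= xt neq_ltn ltnSn.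
have [FF [FFflag FFT] FFbars] := IHt y erefl.
have [a [yxa _]] := hQ.1 y x xy.
have [R [R00 Rfollows [GG [GGflag GGT] GGtransfer]]] :=
  transfer_arrow yxa FFflag FFT.
exists GG => // B Badapt.
have [T Tadapt match_TB] := GGtransfer B Badapt.
have [I [e [eT ebasis efollows]]] := FFbars T Tadapt.
have [J [e' [e'B e'R e'basis e'cases]]] :=
  extend_family R00 yx Tadapt.1 eT match_TB.
exists J, e'; split=> // [z zx|b sb tb j].
  have [->|zNx] := eqVneq z x.
    exists B; split=> //; first exact: Badapt.1.
    apply/seteqP; split=> // v _.
    by apply: span_mono (Badapt.2 setT GGT v Logic.I) => w [].
  by apply: e'basis => //; apply: ebasis; rewrite -ltnS -xy ltn_neqAle zNx.
have [->|[sy ty]] := type_A_last_arrow xy yxa sb tb; first exact/Rfollows/e'R.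
have neq (z : 'I_n) : (z <= y)%N -> z != x.
  by move=> zy; rewrite -val_eqE /= neq_ltn xy ltnS zy.
rewrite /follows; case: (e'cases j) => [[i e'i]|e'0].
  by rewrite !e'i ?neq //; apply: efollows.
by right; rewrite e'0 ?neq // linear0.
Qed.

End Bars.

(** * Finitely supported families and direct sums *)

Section DsumEval.
Variables (k : fieldType) (I : choiceType) (E : I -> lmodType k).
Variables (F : lmodType k) (phi : forall i, {linear E i -> F}).

Definition dsum_eval (u : dsum E) : F := \sum_(i \in setT) phi i (u i).

Lemma dsum_support (u : dsum E) :
  exists2 r : seq I, uniq r & forall i, i \notin r -> u i = 0.
Proof.
have /finite_seqP[r ur] := dsum_finite u.
exists (undup r) => [|i]; first exact: undup_uniq.
rewrite mem_undup => /negP ir; apply: contrapT => ui; apply: ir.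
by have : [set` r] i by rewrite -ur.
Qed.

Lemma dsum_evalE (u : dsum E) (r : seq I) :
  uniq r -> (forall i, i \notin r -> u i = 0) ->
  dsum_eval u = \sum_(i <- r) phi i (u i).
Proof.
move=> runiq ur; rewrite /dsum_eval (fsbigE r) //.
  by apply: eq_bigl => i; rewrite in_setT.
by move=> i _ /ur ->; rewrite linear0.
Qed.

Lemma dsum_eval_is_linear : linear dsum_eval.
Proof.
move=> c u v; have [r _ ru] := dsum_support u; have [t _ tv] := dsum_support v.
have sup (w : dsum E) : (forall i, i \notin r -> i \notin t -> w i = 0) ->
    dsum_eval w = \sum_(i <- undup (r ++ t)) phi i (w i).
  move=> w0; apply: dsum_evalE => [|i]; first exact: undup_uniq.
  by rewrite mem_undup mem_cat negb_or => /andP[]; apply: w0.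
rewrite !sup => [|i _ /tv //|i /ru //|i ir it].
  by rewrite scaler_sumr -big_split; apply: eq_bigr => i _; rewrite /= linearP.
by rewrite /= ru // tv // scaler0 addr0.
Qed.

HB.instance Definition _ :=
  GRing.isLinear.Build k (dsum E) F *:%R dsum_eval dsum_eval_is_linear.

Lemma dsum_single_finite (i : I) (w : E i) :
  finite_set [set j | @dfwith I E (fun=> 0) i w j <> 0].
Proof.
apply: (sub_finite_set _ (finite_set1 i)) => j /=.
by have [/esym //|ij] := eqVneq i j; rewrite dfwith_out.
Qed.

Definition dsum_single (i : I) (w : E i) : dsum E := Dsum (dsum_single_finite w).

Lemma dsum_eval_single (i : I) (w : E i) :
  dsum_eval (dsum_single w) = phi i w.
Proof.
rewrite (@dsum_evalE _ [:: i]) => [|//|j]; first by rewrite big_seq1 /= dfwith_in.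
by rewrite inE eq_sym => ij; rewrite /= dfwith_out.
Qed.

End DsumEval.

(** * Bars as thin representations *)

Section ThinBars.
Variables (k : fieldType) (V : Type) (Q : quiver V) (M : representation k Q).

(** The matrix has a single entry when both lines are nonzero, and is empty
    otherwise. *)
Definition bar_map (s : forall z, M z) (a : arrow Q) :
    {linear 'rV[k]_(s (source a) != 0) -> 'rV[k]_(s (target a) != 0)} :=
  mulmxr (const_mx (rep_map M a (s (source a)) != 0)%:R).

(** Row vectors, of length one where [s] is nonzero and zero elsewhere, stand for
    the line spanned by [s], with [s] itself as the coordinate vector. *)
Definition bar_rep (s : forall z, M z) : representation k Q :=
  @Repr k V Q (fun z => 'rV[k]_(s z != 0)) (bar_map s).

Lemma thin_bar_rep s : thin (bar_rep s).
Proof.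
move=> z; exists (s z != 0); first by case: (s z != 0).
by constructor; exists id => //; exists id.
Qed.

(** The sum of the entries is the only entry, or zero if there is none. *)
Definition bar_eval (s : forall z, M z) z (w : bar_rep s z) : M z :=
  (\sum_j (w : 'rV[k]__) ord0 j) *: s z.

Lemma bar_eval_is_linear s z : linear (@bar_eval s z).
Proof.
move=> c u v; rewrite /bar_eval scalerA -scalerDl mulr_sumr -big_split.
by congr (_ *: _); apply: eq_bigr => j _; rewrite !mxE.
Qed.

HB.instance Definition _ s z := GRing.isLinear.Build k (bar_rep s z) (M z) *:%R
  (@bar_eval s z) (@bar_eval_is_linear s z).

Lemma bar_eval_eq0 s z (w : bar_rep s z) :
  \sum_j (w : 'rV[k]__) ord0 j = 0 -> w = 0.
Proof.
rewrite /= in w *; move: w; case: (s z != 0) => /= w; last by rewrite thinmx0.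
by rewrite big_ord1 => w0; apply/rowP => j; rewrite ord1 mxE.
Qed.

Lemma bar_eval_onto s z : exists w : bar_rep s z, bar_eval w = s z.
Proof.
exists (const_mx 1 : 'rV_(_)); rewrite /bar_eval.
under eq_bigr do rewrite mxE.
rewrite sumr_const card_ord; have [->|_] := eqVneq (s z) 0.
  by rewrite scaler0.
by rewrite scale1r.
Qed.

Lemma bar_eval_map (s : forall z, M z) (a : arrow Q)
    (w : bar_rep s (source a)) :
  follows a s ->
  bar_eval (rep_map (bar_rep s) a w) = rep_map M a (bar_eval w).
Proof.
rewrite /bar_eval linearZ /=.
set c : k := (_ != 0)%:R.
have -> : \sum_j ((w : 'rV[k]__) *m const_mx c : 'rV_(s (target a) != 0)) ord0 j
    = (\sum_i (w : 'rV[k]__) ord0 i) * c *+ (s (target a) != 0).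
  under eq_bigr => j _.
    rewrite mxE; under eq_bigr do rewrite mxE.
    rewrite -mulr_suml; over.
  by rewrite sumr_const card_ord.
rewrite /c => -[->|->]; last by rewrite eqxx mulr0 mul0rn scale0r scaler0.
have [->|_] := eqVneq (s (target a)) 0; first by rewrite !scaler0.
by rewrite mulr1.
Qed.

End ThinBars.

Lemma linear_inverse (k : fieldType) (U V : lmodType k) (f : {linear U -> V}) :
  injective f -> range f = setT ->
  exists g : {linear V -> U}, cancel g f /\ cancel f g.
Proof.
move=> finj fonto; have pre v : exists u, f u = v.
  by have [u _ <-] : range f v; [rewrite fonto | exists u].
have [g gf] := choice pre.
have fg : cancel f g by move=> u; apply: finj.
pose g_linear := GRing.isLinear.Build k V U *:%R g (GRing.can2_linear fg gf).
pose gL : {linear V -> U} := HB.pack g g_linear.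
by exists gL.
Qed.

Section Decomposition.
Variables (k : fieldType) (V : Type) (Q : quiver V) (M : representation k Q).
Variables (I : choiceType) (e : I -> forall z, M z).

Definition bars_eval z : {linear dsum (fun i => bar_rep (e i) z) -> M z} :=
  dsum_eval (fun i => @bar_eval k V Q M (e i) z).

(** A nonzero component of a vector sent to zero would express one element of
    the basis by the others. *)
Lemma bars_eval_inj z : family_basis (e^~ z) -> injective (bars_eval z).
Proof.
move=> [B [Bfree _ [eB einj _]]].
suff ker0 : forall u, bars_eval z u = 0 -> u = 0.
  by move=> u v uv; apply/subr0_eq/ker0; rewrite linearB uv subrr.
move=> u u0; apply: dsum_eq => j; apply: bar_eval_eq0; apply/eqP.
apply/negPn/negP => ujN0.
have [r runiq ur] := dsum_support u.
have jr : j \in r.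
  apply: contraNT ujN0 => /ur ->; rewrite big1 // => i _; exact: mxE.
have ejN0 : e j z != 0.
  apply: contraNneq ujN0 => ej; move: (u j : 'rV_(_)); rewrite ej eqxx => w.
  by rewrite big_ord0.
apply: (Bfree _ (eB j ejN0)); rewrite set0U.
apply: (subspaceZK (subspace_span _) ujN0).
have := u0; rewrite /bars_eval /= (dsum_evalE _ runiq ur) (bigD1_seq j) //=.
rewrite -[X in X + _]/(_ *: e j z) => /eqP; rewrite addr_eq0 => /eqP ->.
rewrite -scaleN1r; apply: (subspaceZ _ (subspace_span _)).
apply: big_ind => [|v w|i ij]; [exact: span0|exact: subspaceD (subspace_span _)|].
apply: (subspaceZ _ (subspace_span _)).
have [->|eiN0] := eqVneq (e i z) 0; first exact: span0.
apply: sub_span; split; first exact: eB.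
by move=> /(einj _ _ eiN0) eij; rewrite eij eqxx in ij.
Qed.

Lemma bars_eval_onto z : family_basis (e^~ z) -> range (bars_eval z) = setT.
Proof.
move=> [B [_ Bgen [_ _ Be]]]; apply/seteqP; split=> // v _.
have : span B v by rewrite Bgen.
apply: span_sub.
  by apply: subspace_image; apply: subspaceT.
move=> _ /Be[i _ <-]; have [w <-] := bar_eval_onto (e i) z.
exists (dsum_single (E := fun i => bar_rep (e i) z) w) => //.
exact: dsum_eval_single.
Qed.

Lemma bars_eval_map (a : arrow Q) u : (forall i, follows a (e i)) ->
  bars_eval (target a) (rep_map (rep_dsum (fun i => bar_rep (e i))) a u) =
  rep_map M a (bars_eval (source a) u).
Proof.
move=> efollows; have [r runiq ur] := dsum_support u.
rewrite /bars_eval /= (dsum_evalE _ runiq ur) linear_sum.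
rewrite (dsum_evalE _ runiq) => [|i /ur ui]; last by rewrite /= ui mul0mx.
by apply: eq_bigr => i _; apply: bar_eval_map.
Qed.

Lemma bars_decomposition :
  (forall z, family_basis (e^~ z)) -> (forall a i, follows a (e i)) ->
  rep_iso M (rep_dsum (fun i => bar_rep (e i))).
Proof.
move=> ebasis efollows.
have inv z := cid (linear_inverse (bars_eval_inj (ebasis z))
  (bars_eval_onto (ebasis z))).
exists (fun z => projT1 (inv z)); split=> [z|a v].
  by have [gK Kg] := projT2 (inv z); exists (bars_eval z).
have [gsK _] := projT2 (inv (source a)); have [_ Kgt] := projT2 (inv (target a)).
by rewrite -{1}[v]gsK -bars_eval_map.
Qed.

End Decomposition.

Theorem mainTheorem1 (k : fieldType) (n : nat) (hn : (0 < n)%N)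
    (Q : quiver 'I_n) (hQ : quiver_type_A Q) (M : representation k Q) :
  exists (I : Type) (N : I -> representation k Q),
    (forall i : I, thin (N i)) /\ rep_iso M (rep_dsum N).
Proof.
case: n hn Q hQ M => // n _ Q hQ M.
have [FF [FFflag _] FFbars] := bars_upto M hQ ord_max.
have [||B [_ _ Badapt]] := adapted_extension FFflag (T := set0).
- by move=> v [].
- move=> F _ v [v0 _]; apply: span_mono v0 => u [].
have [I [e [_ ebasis efollows]]] := FFbars B Badapt.
exists I, (fun i => bar_rep (e i)); split=> [i|]; first exact: thin_bar_rep.
apply: bars_decomposition => [z|a i]; first by apply: ebasis; apply: leq_ord.
by apply: efollows; apply: leq_ord.
Qed.
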